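(* In the streaming setting, any algorithm for the Circular Pattern Matching problem uses $\Omega(m)$ bits of space, where $m$ is the length of the pattern.
   Context: Circular Pattern Matching (CPM): given a pattern $P$ of length $m$ and a text $T$ of length $n$, report all occurrences in $T$ of rotations of $P$ (a rotation of $P$ is $P[\Delta+1\mathinner{.\,.} m]P[1\mathinner{.\,.}\Delta]$ for some $\Delta\in[1\mathinner{.\,.} m]$). In the streaming setting the pattern and then the text arrive letter by letter as a stream, and all space used is accounted for, including any information stored about the input. *)

(* Defs.v *)
From HB Require Import structures.
From mathcomp Require Import all_boot all_order all_algebra.
From mathcomp Require Import all_classical all_reals all_analysis.

Set Implicit Arguments.
Unset Strict Implicit.
Unset Printing Implicit Defensive.

Import Order.TTheory GRing.Theory Num.Theory.
Local Open Scope classical_set_scope.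
Local Open Scope ring_scope.

(* A one-pass randomized streaming algorithm.  Its whole memory is a bit
   string.  The following are provided free of charge, so that a space lower
   bound is valid for every weaker model: the random seed [w : Omega] (an
   algorithm drawing fresh coins is the case where [w] lists all of them), the
   number of letters of the current phase already read (first [nat] argument),
   and which of the two phases is running.  [report w k s a] lists the (0-based)
   starting positions written to the output when the text letter [a], preceded
   by [k] text letters, is read with memory [s]. *)
Record stream_alg (Sigma Omega : Type) := StreamAlg {
  init : Omega -> seq bool;
  read_pattern : Omega -> nat -> seq bool -> Sigma -> seq bool;
  read_text : Omega -> nat -> seq bool -> Sigma -> seq bool;
  report : Omega -> nat -> seq bool -> Sigma -> seq nat }.

Fixpoint run (Sigma : Type) (step : nat -> seq bool -> Sigma -> seq bool)
    (k : nat) (s : seq bool) (u : seq Sigma) : seq bool :=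
  if u is a :: u' then run step k.+1 (step k s a) u' else s.

Definition mem_pattern (Sigma Omega : Type) (A : stream_alg Sigma Omega)
    (w : Omega) (P : seq Sigma) : seq bool :=
  run (read_pattern A w) 0 (init A w) P.

Definition mem_text (Sigma Omega : Type) (A : stream_alg Sigma Omega)
    (w : Omega) (P T : seq Sigma) : seq bool :=
  run (read_text A w) 0 (mem_pattern A w P) T.

Definition reports (Sigma Omega : Type) (A : stream_alg Sigma Omega)
    (w : Omega) (P T : seq Sigma) (a : Sigma) : seq nat :=
  report A w (size T) (mem_text A w P T) a.

Definition is_rotation (Sigma : Type) (P U : seq Sigma) : Prop :=
  exists2 D : nat, (1 <= D <= size P)%N & U = rot D P.

Definition circ_occ (Sigma : Type) (P T : seq Sigma) (p : nat) : Prop :=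
  (p + size P <= size T)%N /\ is_rotation P (take (size P) (drop p T)).

(* Occurrences may be reported with an arbitrary delay, but every report must
   be an occurrence in the part of the text read so far. *)
Definition correct_run (Sigma Omega : Type) (A : stream_alg Sigma Omega)
    (w : Omega) (P T : seq Sigma) : Prop :=
  (forall (T1 T2 : seq Sigma) (a : Sigma) (p : nat), T = T1 ++ a :: T2 ->
     p \in reports A w P T1 a -> circ_occ P (rcons T1 a) p) /\
  (forall p : nat, circ_occ P T p ->
     exists (T1 T2 : seq Sigma) (a : Sigma),
       T = T1 ++ a :: T2 /\ p \in reports A w P T1 a).

(* Correctness with probability at least [delta] on every input; a
   deterministic algorithm satisfies this with [delta = 1]. *)
Definition solves_cpm (R : realType) (d : measure_display)
    (Omega : measurableType d) (Pr : probability Omega R) (Sigma : Type)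
    (A : stream_alg Sigma Omega) (delta : R) (m n : nat) : Prop :=
  forall P T : seq Sigma, size P = m -> size T = n ->
    measurable [set w | correct_run A w P T] /\
    (delta%:E <= Pr [set w | correct_run A w P T])%E.

Definition space_le (Sigma Omega : Type) (A : stream_alg Sigma Omega)
    (m n s : nat) : Prop :=
  forall (w : Omega) (P : seq Sigma),
    ((size P <= m)%N -> (size (mem_pattern A w P) <= s)%N) /\
    (size P = m -> forall T : seq Sigma, (size T <= n)%N ->
       (size (mem_text A w P T) <= s)%N).

(* Main.v *)
Require Import Defs.
From HB Require Import structures.
From mathcomp Require Import all_boot all_order all_algebra.
From mathcomp Require Import all_classical all_reals all_analysis.
From mathcomp Require Import measurable_realfun ring lra zify.

Set Implicit Arguments.
Unset Strict Implicit.
Unset Printing Implicit Defensive.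

Import Order.TTheory GRing.Theory Num.Theory.
Local Open Scope ring_scope.

(** The text may start with a copy of the pattern [P] itself, followed by
    [P[0..i)] and the letter [x].  The window at position [i + 1] is then
    [P[i+1..m) P[0..i) x], and counting letters shows that it is a rotation of
    [P] exactly when [P[i] = x].  So the memory [M] held after [P] has been
    read twice predicts each bit of [P] from the preceding ones
    (augmented indexing).

    Fix a seed for which a fraction [a > 1/2] of all pairs [(P, i)] is handled
    correctly.  For a fixed [M], the map sending [P] to its vector of correctly
    predicted positions is a bijection of [{0,1}^m], so summing
    [q ^ (number of correct predictions)] over all [P] gives [(1 + q)^m].
    There are at most [4^s] memory contents of at most [s] bits, and
    comparing with the average [a m] of correct predictions yields
    [1 <= 4^s g^m] for a constant [g < 1]. *)

(** * Counting correct predictions *)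

Definition score (f : seq bool -> bool) (u : seq bool) : nat :=
  (\sum_(i < size u) (f (take i u) == nth false u i))%N.

Lemma score_cons (f : seq bool -> bool) (b : bool) (u : seq bool) :
  score f (b :: u) = ((f [::] == b) + score (fun v => f (b :: v)) u)%N.
Proof. by rewrite /score /= big_ord_recl. Qed.

Lemma sum_tupleS (R : nmodType) (m : nat) (F : seq bool -> R) :
  \sum_(P : m.+1.-tuple bool) F P =
  \sum_(P : m.-tuple bool) F (true :: P) +
  \sum_(P : m.-tuple bool) F (false :: P).
Proof.
rewrite (reindex (fun p : bool * m.-tuple bool => [tuple of p.1 :: p.2])) /=.
  by rewrite -(pair_bigA _ (fun b (P : m.-tuple bool) => F (b :: P))) big_bool.
exists (fun t : m.+1.-tuple bool => (thead t, [tuple of behead t])).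
- by case=> b P _ /=; congr pair; apply: val_inj.
- by move=> t _; rewrite [RHS]tuple_eta.
Qed.

(** Either value of [f [::]] matches exactly one of the two first letters: one half of the cube
    gains a factor [q], the other none, and neither remaining sum depends on the predictor. *)
Lemma sum_exp_score (R : comNzRingType) (q : R) (m : nat)
    (f : seq bool -> bool) :
  \sum_(P : m.-tuple bool) q ^+ score f P = (1 + q) ^+ m.
Proof.
elim: m f => [|m IHm] f.
  rewrite (eq_bigr (fun=> 1)) => [|P _]; last first.
    by rewrite (tuple0 P) /score big_ord0 expr0.
  by rewrite sumr_const card_tuple expr0.
rewrite (@sum_tupleS _ m (fun P => q ^+ score f P)).
under eq_bigr => P _ do rewrite score_cons exprD.
under [X in _ + X]eq_bigr => P _ do rewrite score_cons exprD.
rewrite -!mulr_sumr !IHm exprS -mulrDl.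
by case: (f [::]); rewrite /= expr0 expr1 // addrC.
Qed.

(** Counts the bit strings of length at most [s]. The crude base 4 leaves no additive constant in
    the final bound. *)
Lemma sum_exp2_le (R : numDomainType) (s : nat) :
  \sum_(k < s.+1) (2 ^+ k : R) <= 4 ^+ s.
Proof.
elim: s => [|s IHs]; first by rewrite big_ord_recr big_ord0 /= add0r !expr0.
rewrite big_ord_recr /=; apply: le_trans (lerD IHs (lexx _)) _.
have h24 : (2 ^+ s : R) <= 4 ^+ s.
  by apply: lerXn2r; rewrite ?nnegrE ?ler0n ?ler_nat.
rewrite !exprS.
have -> : (4 * 4 ^+ s : R) = 4 ^+ s + 2 * 4 ^+ s + 4 ^+ s by ring.
rewrite -addrA lerD2l; apply: le_trans (_ : 2 * 4 ^+ s <= _).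
  by rewrite ler_pM2l ?ltr0n.
by rewrite lerDl exprn_ge0 ?ler0n.
Qed.

(** The predictor varies with [msg P]; summing over every possible memory [M] adds only nonnegative
    terms and makes it fixed in each inner sum. *)
Lemma augmented_index_le (R : numDomainType) (q : R) (m s : nat)
    (msg : seq bool -> seq bool) (f : seq bool -> seq bool -> bool) :
  0 <= q -> (forall P : m.-tuple bool, (size (msg P) <= s)%N) ->
  \sum_(P : m.-tuple bool) q ^+ score (f (msg P)) P <= 4 ^+ s * (1 + q) ^+ m.
Proof.
move=> q0 msg_le.
apply: (@le_trans _ _ (\sum_(P : m.-tuple bool) \sum_(k < s.+1)
    \sum_(M : k.-tuple bool) q ^+ score (f M) P)).
  apply: ler_sum => P _.
  have hk : (size (msg P) < s.+1)%N by rewrite ltnS.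
  rewrite (bigD1 (Ordinal hk)) //= (bigD1 (in_tuple (msg P))) //= -addrA lerDl.
  by rewrite addr_ge0 ?sumr_ge0 // => *;
    rewrite ?sumr_ge0 // => *; rewrite exprn_ge0.
rewrite exchange_big /=.
under eq_bigr => k _.
  rewrite exchange_big /=.
  under eq_bigr => M _ do rewrite sum_exp_score.
  rewrite sumr_const card_tuple card_bool -mulr_natl natrX.
  over.
rewrite -mulr_suml ler_wpM2r ?exprn_ge0 ?addr_ge0 //.
exact: sum_exp2_le.
Qed.

(** * Choice of the seed and of the exponential rate *)

(** Otherwise the expected number of good indices would be at most [a * #|I|], below the [b * #|I|]
    forced by linearity. *)
Lemma exists_sum_indic_ge (R : realType) (d : measure_display)
    (Omega : measurableType d) (Pr : probability Omega R) (I : finType)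
    (E : I -> set Omega) (a b : R) :
  0 <= a < b -> (0 < #|I|)%N -> (forall i, measurable (E i)) ->
  (forall i, (b%:E <= Pr (E i))%E) ->
  exists w, a * #|I|%:R <= \sum_i (w \in E i)%:R.
Proof.
move=> /andP[a0 ab] I0 mE hE; apply: contrapT => /forallNP hlt.
have : (\int[Pr]_w (\sum_i (\1_(E i) w)%:E) <=
    \int[Pr]_w cst (a * #|I|%:R)%:E w)%E.
  apply: ge0_le_integral => //.
  - by move=> w _; apply: sume_ge0 => i _; rewrite lee_fin.
  - apply: emeasurable_sum => i.
    by apply/measurable_EFinP; exact: measurable_indic.
  - move=> w _; rewrite sumEFin lee_fin.
    have /negP := hlt w; rewrite -ltNge => /ltW.
    by under eq_bigr => i _ do rewrite -indicE.
rewrite ge0_integral_sum //; last first.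
  by move=> i; apply/measurable_EFinP; exact: measurable_indic.
rewrite integral_cst //= probability_setT mule1.
under eq_bigr => i _ do rewrite integral_indic // setIT.
apply/negP; rewrite -ltNge.
apply: (@lt_le_trans _ _ (\sum_(i : I) b%:E)%E).
  by rewrite sumEFin lte_fin sumr_const -[b *+ _]mulr_natr ltr_pM2r // ltr0n.
by apply: lee_sum => i _; exact: hE.
Qed.

(** A Chernoff factor: the mean of [expR (l * (X - a))] for a fair bit [X]. With [l = 2 * a - 1],
    bounding both exponentials by [expR t <= (1 - t)^-1] suffices. *)
Lemma exists_exp_rate (R : realType) (a : R) : 1 / 2 < a < 1 ->
  exists2 l : R, 0 < l & (1 + expR l) / 2 * expR (- (l * a)) < 1.
Proof.
move=> /andP[ha ha1].
have [l lE] : exists l : R, l = 2 * a - 1 by exists (2 * a - 1).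
have l0 : 0 < l by lra.
exists l => //.
have h1 : expR (- (l * a)) <= (1 + l * a)^-1.
  by rewrite expRN lef_pV2 ?posrE ?expR_gt0 ?expR_ge1Dx //; nra.
have hp : 0 < 1 - l * (1 - a) by rewrite lE; nra.
have h2 : expR (l * (1 - a)) <= (1 - l * (1 - a))^-1.
  rewrite -[leLHS]invrK -expRN lef_pV2 ?posrE ?expR_gt0 //.
  by rewrite expR_ge1Dx.
have -> : (1 + expR l) / 2 * expR (- (l * a)) =
    (expR (- (l * a)) + expR (l * (1 - a))) / 2.
  by rewrite mulrBr mulr1 expRD; field.
have : (1 + l * a)^-1 + (1 - l * (1 - a))^-1 < 2; last by lra.
have hq : 0 < 1 + l * a by nra.
have -> : (1 + l * a)^-1 + (1 - l * (1 - a))^-1 =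
   (2 + l * (2 * a - 1)) / ((1 + l * a) * (1 - l * (1 - a))).
  by field; apply/andP; split; lra.
rewrite ltr_pdivrMr ?mulr_gt0 // -lE -subr_gt0.
have -> : 2 * ((1 + l * a) * (1 - l * (1 - a))) - (2 + l * l) =
    l ^+ 2 * (1 - 2 * a * (1 - a)) by rewrite lE; ring.
by rewrite mulr_gt0 ?exprn_gt0 //; nra.
Qed.

(** * Hard texts and the decoder *)

Lemma run_cat (Sigma : Type) (step : nat -> seq bool -> Sigma -> seq bool)
    (k : nat) (s : seq bool) (u v : seq Sigma) :
  run step k s (u ++ v) = run step (k + size u) (run step k s u) v.
Proof.
by elim: u k s => [|a u IHu] k s; rewrite /= ?addn0 // IHu addSnnS.
Qed.

Definition letter (Sigma : Type) (x y : Sigma) (b : bool) : Sigma :=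
  if b then x else y.

Lemma letter_inj (Sigma : Type) (x y : Sigma) : x <> y ->
  injective (letter x y).
Proof. by move=> xy [] [] //= e; case: xy. Qed.

(* What follows the copy of [P] in the text, for [u = P[0..i)], padded so that
   the text has length [n]. *)
Definition probe (n m : nat) (u : seq bool) : seq bool :=
  u ++ true :: nseq (n - m - (size u).+1) true.

Lemma rotation_probe (Sigma : Type) (x y : Sigma) (P : seq bool) (n i : nat) :
  x <> y -> (i < size P)%N -> (2 * size P <= n)%N ->
  circ_occ (map (letter x y) P)
    (map (letter x y) (P ++ probe n (size P) (take i P))) i.+1
  <-> nth false P i = true.
Proof.
move=> xy iP hn.
have szi : size (take i P) = i by rewrite size_take iP.
have hw : take (size P) (drop i.+1 (P ++ probe n (size P) (take i P))) =
    drop i.+1 P ++ rcons (take i P) true.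
  rewrite drop_cat.
  have hs : (size (drop i.+1 P ++ rcons (take i P) true)) = size P.
    by rewrite size_cat size_rcons size_drop szi subnK.
  rewrite /probe -cat_rcons.
  (* The other case is [i.+1 = size P], where the window starts right after the leading copy. *)
  case: ltnP => h; first by rewrite catA -{1}hs take_size_cat.
  have -> : (i.+1 - size P = 0)%N by lia.
  by rewrite drop0 drop_oversize //= take_size_cat // -hs drop_oversize.
rewrite /circ_occ /is_rotation -map_drop -map_take !size_map hw.
have Pi : rot i.+1 P = drop i.+1 P ++ rcons (take i P) (nth false P i).
  by rewrite /rot -take_nth.
split.
- move=> [_ [D _]]; rewrite -map_rot => /(inj_map (letter_inj xy)) e.
  (* Rotations contain equally many [true], and only the last letter of the window can differ from
     [rot i.+1 P]. *)
  have /permP/(_ id) : perm_eq (rot i.+1 P) (rot D P).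
    by rewrite perm_rot perm_sym perm_rot.
  rewrite -e Pi !count_cat -!cats1 !count_cat /=; case: (nth _ _ _) => //; lia.
- move=> e; split.
    rewrite size_cat /probe size_cat /= size_nseq szi; lia.
  exists i.+1; first by lia.
  by rewrite -map_rot Pi e.
Qed.

Lemma circ_occ_cat (Sigma : Type) (P T U : seq Sigma) (p : nat) :
  circ_occ P T p -> circ_occ P (T ++ U) p.
Proof.
move=> [le rotP]; split; first by rewrite size_cat; lia.
suff -> : drop p (T ++ U) = drop p T ++ U.
  by rewrite takel_cat // size_drop; lia.
rewrite drop_cat; case: ltnP => // h.
have -> : (p - size T = 0)%N by lia.
by rewrite drop0 drop_oversize.
Qed.

(* A correct run cannot report position [i + 1] while the leading copy of [P] is
   being read, so only reports made after it are inspected. *)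
Definition decode (Sigma Omega : Type) (x y : Sigma)
    (A : stream_alg Sigma Omega) (w : Omega) (n m : nat)
    (M u : seq bool) : bool :=
  `[< exists (V1 V2 : seq Sigma) (a : Sigma),
      map (letter x y) (probe n m u) = V1 ++ a :: V2 /\
      (size u).+1 \in
        report A w (m + size V1) (run (read_text A w) m M V1) a >].

Lemma decode_correct (Sigma Omega : Type) (x y : Sigma)
    (A : stream_alg Sigma Omega) (w : Omega) (P : seq bool) (n i : nat) :
  x <> y -> (i < size P)%N -> (2 * size P <= n)%N ->
  correct_run A w (map (letter x y) P)
    (map (letter x y) (P ++ probe n (size P) (take i P))) ->
  decode x y A w n (size P)
    (mem_text A w (map (letter x y) P) (map (letter x y) P)) (take i P) =
  nth false P i.
Proof.
move=> xy iP hn [sound complete].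
have szi : size (take i P) = i by rewrite size_take iP.
have occP := rotation_probe xy iP hn.
have memE V : run (read_text A w) (size P)
      (mem_text A w (map (letter x y) P) (map (letter x y) P)) V =
    mem_text A w (map (letter x y) P) (map (letter x y) P ++ V).
  by rewrite /mem_text run_cat add0n size_map.
apply/idP/idP.
- move=> /asboolP[V1 [V2 [a [eV]]]]; rewrite szi => rep.
  apply/occP; rewrite map_cat eV -cat_rcons catA -rcons_cat.
  apply/circ_occ_cat/(sound _ V2).
    by rewrite map_cat eV -catA.
  by rewrite /reports size_cat size_map -memE.
- move=> /occP/complete[T1 [T2 [a [eT rep]]]].
  (* The window at [i.+1] ends beyond the copy of [P], so by soundness its report comes after that
     copy. *)
  have [le _] := sound _ _ _ _ eT rep.
  have {}le : (size P <= size T1)%N.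
    by move: le; rewrite size_rcons size_map; lia.
  have hT1 : T1 = map (letter x y) P ++ drop (size P) T1.
    rewrite -{1}(cat_take_drop (size P) T1); congr (_ ++ _).
    rewrite -(takel_cat (a :: T2) le) -eT map_cat take_size_cat //.
    by rewrite size_map.
  apply/asboolP; exists (drop (size P) T1), T2, a; split.
    have := congr1 (drop (size P)) eT.
    rewrite map_cat drop_size_cat ?size_map // => ->.
    by rewrite {1}hT1 -catA drop_size_cat ?size_map.
  by rewrite szi memE -hT1 size_drop subnKC.
Qed.

(** * From prediction to space *)

Theorem theorem24 (R : realType) (delta : R) (hdelta : 1 / 2 < delta) :
  exists2 c : R, 0 < c &
    forall (Sigma : Type) (x y : Sigma), x <> y ->
    forall (d : measure_display) (Omega : measurableType d)
      (Pr : probability Omega R) (A : stream_alg Sigma Omega) (m n s : nat),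
      (2 * m <= n)%N ->
      solves_cpm Pr A delta m n ->
      space_le A m n s ->
      c * m%:R <= s%:R.
Proof.
(* The rate needs [a < 1], while [delta >= 1] is allowed; hence two cases. *)
have [a ha hda] : exists2 a : R, 1 / 2 < a < 1 & a < delta.
  have [h|h] := ltP delta 1.
    by exists ((1 / 2 + delta) / 2); [apply/andP; split|]; lra.
  by exists (3 / 4); [apply/andP; split|]; lra.
have /andP[ha0 _] := ha.
have [l l0 hl] := exists_exp_rate ha.
pose g := (1 + expR l) / 2 * expR (- (l * a)).
have g0 : 0 < g by rewrite !mulr_gt0 ?addr_gt0 ?expR_gt0 ?invr_gt0.
have ln4 : 0 < ln (4 : R) by rewrite ln_gt0 // ltr1n.
have lng : 0 < - ln g by rewrite oppr_gt0 ln_lt0 // g0.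
(* Obtained by solving [1 <= 4 ^+ s * g ^+ m] for [s]. *)
exists (- ln g / ln 4); first by rewrite divr_gt0.
move=> Sigma x y xy d Omega Pr A m n s mn hA hs.
have [->|m0] := posnP m; first by rewrite mulr0 ler0n.
rewrite mulrAC ler_pdivrMr // mulNr -subr_ge0 opprK.
suff key : 1 <= 4 ^+ s * g ^+ m.
  have := ln_ge0 key.
  rewrite lnM ?posrE ?exprn_gt0 // !lnXn //.
  rewrite -[ln 4 *+ _]mulr_natr -[ln g *+ _]mulr_natr.
  by rewrite [ln 4 * _]mulrC [ln g * _]mulrC.
pose L := map (letter x y).
pose E (j : m.-tuple bool * 'I_m) : set Omega :=
  [set w | correct_run A w (L j.1) (L (j.1 ++ probe n m (take j.2 j.1)))]%classic.
have hE j : measurable (E j) /\ (delta%:E <= Pr (E j))%E.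
  apply: hA; first by rewrite size_map size_tuple.
  rewrite size_map !size_cat /= size_nseq size_take size_tuple ltn_ord.
  have := ltn_ord j.2; lia.
have [||w hw] := @exists_sum_indic_ge R d Omega Pr _ E a delta _ _
  (fun j => (hE j).1) (fun j => (hE j).2).
- by apply/andP; split => //; lra.
- by rewrite card_prod card_tuple card_ord card_bool muln_gt0 expn_gt0.
pose msg (P : seq bool) := mem_text A w (L P) (L P).
have hsc (P : m.-tuple bool) :
    \sum_(i < m) (w \in E (P, i))%:R <=
    (score (decode x y A w n m (msg P)) P)%:R :> R.
  rewrite /score natr_sum size_tuple; apply: ler_sum => i _.
  rewrite ler_nat; case: (boolP (w \in _)) => // /set_mem hwE.
  have szP := size_tuple P.
  have := @decode_correct Sigma Omega x y A w P n i xy.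
  by rewrite szP => /(_ (ltn_ord i) mn hwE) ->; rewrite eqxx.
have msg_le (P : m.-tuple bool) : (size (msg P) <= s)%N.
  by apply: (hs w (L P)).2; rewrite size_map size_tuple //; lia.
have hup := augmented_index_le (decode x y A w n m) (expR_ge0 l) msg_le.
(* Averaging [1 + t <= expR t] over all patterns replaces Jensen's inequality. *)
have hlow : (2 ^+ m : R) <= \sum_(P : m.-tuple bool)
    expR (l * ((score (decode x y A w n m (msg P)) P)%:R - a * m%:R)).
  apply: (@le_trans _ _ (\sum_(P : m.-tuple bool)
      (1 + l * (\sum_(i < m) (w \in E (P, i))%:R - a * m%:R)))).
    rewrite big_split /= sumr_const card_tuple card_bool natrX lerDl.
    rewrite -mulr_sumr mulr_ge0 ?(ltW l0) // sumrB sumr_const.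
    rewrite card_tuple card_bool subr_ge0.
    move: hw; rewrite -(pair_bigA _ (fun P i => (w \in E (P, i))%:R)) /=.
    rewrite card_prod card_tuple card_ord card_bool natrM natrX.
    by rewrite -[_ *+ (2 ^ m)]mulr_natr natrX mulrCA mulrC.
  apply: ler_sum => P _; apply: le_trans (expR_ge1Dx _).
  by rewrite lerD2l ler_pM2l // lerD2r.
have e2 : (0 : R) < 2 ^+ m by rewrite exprn_gt0.
rewrite -(ler_pM2l e2) mulr1; apply: le_trans hlow _.
(* Each term splits into [expR l ^+ score] and a constant [m]-th power, so [hup] applies; the
   [2 ^+ m] is the denominator in [g ^+ m]. *)
under eq_bigr => P _ do
  rewrite mulrBr expRD expRM_natr mulrA -mulNr expRM_natr.
rewrite -mulr_suml; apply: le_trans (ler_wpM2r _ hup) _.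
  by rewrite exprn_ge0 ?expR_ge0.
rewrite /g !exprMn exprVn -mulNr.
by rewrite le_eqVlt; apply/orP; left; apply/eqP; field; rewrite expf_neq0.
Qed.
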